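(* Let $R$ be an indecomposable commutative ring and let $S$ be an idempotent generated commutative $R$-algebra. Then the following are equivalent. (1) $S$ is a Specker $R$-algebra. (2) $S$ is a free $R$-module. (3) $S$ is a projective $R$-module.
   Context: All algebras are commutative and unital. A commutative ring $R$ with $1\ne0$ is indecomposable if its only idempotents are $0$ and $1$. A commutative $R$-algebra $S$ is idempotent generated if it is generated as an $R$-algebra by a set of idempotents. $\mathrm{Id}(S)$ is the set of idempotents of $S$, a Boolean algebra under $e\vee f=e+f-ef$, $e\wedge f=ef$, $\lnot e=1-e$. A nonzero idempotent $e\in S$ is faithful if for each $a\in R$, $ae=0$ implies $a=0$. A faithful generating algebra of idempotents of $S$ is a Boolean subalgebra $B$ of $\mathrm{Id}(S)$ that generates $S$ as an $R$-algebra and all of whose nonzero elements are faithful. $S$ is a Specker $R$-algebra if it is a commutative $R$-algebra that has a faithful generating algebra of idempotents. *)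

(* Defs.v *)
From HB Require Import structures.
From mathcomp Require Import all_boot all_algebra.
From mathcomp Require Import boolp classical_sets.

Set Implicit Arguments.
Unset Strict Implicit.
Unset Printing Implicit Defensive.

Import GRing.Theory.
Local Open Scope ring_scope.
Local Open Scope classical_set_scope.

(* A commutative R-algebra is a commutative ring [S] with a ring morphism
   [iota : R -> S].  We do not use [comAlgType R] because it excludes the zero
   algebra; an [S : comAlgType R] is covered by taking [iota := in_alg S].
   [alg_module iota] is [S] seen as an R-module. *)
Definition alg_module (R S : comPzRingType) (iota : {rmorphism R -> S}) : Type :=
  S.

Section AlgModule.
Variables (R S : comPzRingType) (iota : {rmorphism R -> S}).

HB.instance Definition _ := GRing.Zmodule.on (alg_module iota).

Let scale (a : R) (x : alg_module iota) : alg_module iota := iota a * (x : S).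

Fact alg_module_scaleA a b x : scale a (scale b x) = scale (a * b) x.
Proof. by rewrite /scale rmorphM mulrA. Qed.

Fact alg_module_scale1 : left_id 1 scale.
Proof. by move=> x; rewrite /scale rmorph1 mul1r. Qed.

Fact alg_module_scaleDr : right_distributive scale +%R.
Proof. by move=> a x y; rewrite /scale mulrDr. Qed.

Fact alg_module_scaleDl x : {morph scale^~ x : a b / a + b}.
Proof. by move=> a b; rewrite /scale rmorphD mulrDl. Qed.

HB.instance Definition _ :=
  GRing.Zmodule_isLmodule.Build R (alg_module iota)
    alg_module_scaleA alg_module_scale1 alg_module_scaleDr alg_module_scaleDl.

End AlgModule.

Definition idempotents (S : pzRingType) : set S := [set e | e * e = e].
Arguments idempotents : clear implicits.

(* The condition [1 != 0] is part of [comNzRingType]. *)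
Definition indecomposable (R : comNzRingType) : Prop :=
  forall e : R, idempotents R e -> e = 0 \/ e = 1.

Section Modules.
Variables (R : comNzRingType) (M : lmodType R).

Definition linearly_independent (B : set M) : Prop :=
  forall (s : seq M) (c : M -> R), uniq s -> [set` s] `<=` B ->
    \sum_(b <- s) c b *: b = 0 -> forall b, b \in s -> c b = 0.

Definition spanning (B : set M) : Prop :=
  forall x : M, exists (s : seq M) (c : M -> R),
    [set` s] `<=` B /\ x = \sum_(b <- s) c b *: b.

Definition free_module : Prop :=
  exists B : set M, linearly_independent B /\ spanning B.

Definition projective_module : Prop :=
  forall (N N' : lmodType R) (g : {linear N -> N'}) (f : {linear M -> N'}),
    (forall y, exists x, g x = y) ->
    exists h : {linear M -> N}, forall x, g (h x) = f x.

End Modules.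

Section Algebras.
Variables (R : comNzRingType) (S : comPzRingType) (iota : {rmorphism R -> S}).
Implicit Types (A B G : set S) (e : S).

Definition subalgebra A : Prop :=
  [/\ forall a : R, A (iota a),
      forall x y, A x -> A y -> A (x - y)
    & forall x y, A x -> A y -> A (x * y)].

Definition generates G : Prop := smallest subalgebra G = setT.

Definition idempotent_generated : Prop :=
  exists G, G `<=` idempotents S /\ generates G.

Definition boolean_subalgebra B : Prop :=
  [/\ B `<=` idempotents S,
      B 0 /\ B 1,
      forall e f, B e -> B f -> B (e + f - e * f),
      forall e f, B e -> B f -> B (e * f)
    & forall e, B e -> B (1 - e)].

Definition faithful e : Prop :=
  [/\ idempotents S e, e <> 0 & forall a : R, iota a * e = 0 -> a = 0].

Definition faithful_generating_algebra B : Prop :=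
  [/\ boolean_subalgebra B, generates B
    & forall e, B e -> e <> 0 -> faithful e].

Definition Specker_algebra : Prop := exists B, faithful_generating_algebra B.

End Algebras.

Arguments free_module {R} M.
Arguments projective_module {R} M.

(* Main.v *)
(** Specker implies free is a version of Noebeling's theorem. Well-order the
    faithful algebra of idempotents [B] and compare the monomials
    [e_1 * ... * e_n], [e_1 > ... > e_n], lexicographically. The monomials that
    are not combinations of smaller ones span [S] by well-founded induction.
    They are independent because the span [V] of the monomials below [m] is
    closed under division: if [a * m] lies in [V] and [a <> 0], then [m] lies
    in [V]. Indeed, viewing the elements of [S] as locally constant functions
    with values in [R], the indicator of [a] can be applied to the suffix sums
    of an expression of [a * m], which yields one of [m].

    Projective implies Specker: all idempotents together form a faithful
    generating algebra. For an idempotent [e <> 0], the values at [e] of the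
    linear forms on [S] form a nonzero finitely generated idempotent ideal,
    hence contain 1 as [R] is indecomposable, so that [a * e = 0] forces
    [a = 0]. *)
Require Import Defs.
From HB Require Import structures.
From mathcomp Require Import all_boot all_algebra.
From mathcomp Require Import boolp classical_sets wochoice.
From mathcomp Require Import ring.
From mathcomp.multinomials Require Import freeg.

Set Implicit Arguments.
Unset Strict Implicit.
Unset Printing Implicit Defensive.

Import GRing.Theory.
Local Open Scope ring_scope.
Local Open Scope classical_set_scope.

(** * Free modules, projective modules and dual bases *)

Section FreeProjective.
Variables (R : comNzRingType) (M : lmodType R).

Lemma sum_extend (N : lmodType R) (n : M -> N) (c : M -> R) (s t : seq M) :
    uniq s -> uniq t -> {subset s <= t} ->
  \sum_(b <- t) (if b \in s then c b else 0) *: n b = \sum_(b <- s) c b *: n b.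
Proof.
move=> us ut st; rewrite [LHS](bigID (mem s)) /= addrC big1 ?add0r; last first.
  by move=> b /negbTE ->; rewrite scale0r.
rewrite -big_filter (perm_big s) /=; last first.
  apply: uniq_perm; rewrite ?filter_uniq // => b; rewrite mem_filter.
  by case: (boolP (b \in s)) => // /st ->.
by apply: eq_big_seq => b ->.
Qed.

Lemma sum_undup (c : M -> R) (s : seq M) :
  \sum_(b <- s) c b *: b = \sum_(b <- undup s) (c b *+ count_mem b s) *: b.
Proof.
rewrite -big_undup_iterop_count; apply: eq_bigr => b _.
by rewrite -scalerMnl.
Qed.

Definition lin_combs (B : set M) : set M :=
  [set x | exists (s : seq M) (c : M -> R),
    [set` s] `<=` B /\ x = \sum_(b <- s) c b *: b].

(** [spanning] allows repeated vectors while [linearly_independent] asks for [uniq] lists; a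
    repeated vector gets its coefficient times its multiplicity. *)
Lemma lin_combs_uniq (B : set M) x : lin_combs B x ->
  exists (s : seq M) (c : M -> R),
    [/\ uniq s, [set` s] `<=` B, forall b, b \notin s -> c b = 0
      & x = \sum_(b <- s) c b *: b].
Proof.
move=> [s [c [sB ->]]]; exists (undup s), (fun b => c b *+ count_mem b s).
split; rewrite ?undup_uniq -?sum_undup //.
  by move=> b /=; rewrite mem_undup => /sB.
by move=> b; rewrite mem_undup => /count_memPn ->.
Qed.

Lemma sub_lin_combs (B : set M) : B `<=` lin_combs B.
Proof.
move=> b Bb; exists [:: b], (fun=> 1); rewrite big_seq1 scale1r; split=> //.
by move=> x /=; rewrite inE => /eqP->.
Qed.

Lemma lin_combs0 (B : set M) : lin_combs B 0.
Proof. by exists [::], (fun=> 0); rewrite big_nil. Qed.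

Lemma lin_combs_lin (B : set M) (a : R) x y :
  lin_combs B x -> lin_combs B y -> lin_combs B (a *: x + y).
Proof.
move=> /lin_combs_uniq[s [c [us sB c0 ->]]].
move=> /lin_combs_uniq[t [d [ut tB d0 ->]]].
exists (undup (s ++ t)), (fun b => a * c b + d b); split=> [b /=|].
  by rewrite mem_undup mem_cat => /orP[/sB|/tB].
rewrite -(@sum_extend _ id c s (undup (s ++ t))) ?undup_uniq//; last first.
  by move=> b bs; rewrite mem_undup mem_cat bs.
rewrite -(@sum_extend _ id d t (undup (s ++ t))) ?undup_uniq//; last first.
  by move=> b bs; rewrite mem_undup mem_cat bs orbT.
rewrite scaler_sumr -big_split; apply: eq_bigr => b _ /=.
rewrite scalerDl scalerA; congr (_ * _ *: _ + _ *: _).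
  by case: ifPn => // /c0.
by case: ifPn => // /d0.
Qed.

Lemma spanning_coords (B : set M) : spanning B ->
  exists (s : M -> seq M) (k : M -> M -> R), forall x,
    [/\ uniq (s x), [set` s x] `<=` B, forall b, b \notin s x -> k x b = 0
      & x = \sum_(b <- s x) k x b *: b].
Proof.
move=> spB.
have /choice[sk skP] : forall x, exists sk : seq M * (M -> R),
    [/\ uniq sk.1, [set` sk.1] `<=` B, forall b, b \notin sk.1 -> sk.2 b = 0
      & x = \sum_(b <- sk.1) sk.2 b *: b].
  by move=> x; have [s [c sc]] := lin_combs_uniq (spB x); exists (s, c).
by exists (fun x => (sk x).1), (fun x => (sk x).2).
Qed.

Lemma free_projective : free_module M -> projective_module M.
Proof.
move=> [B [indB /spanning_coords[s [k skP]]]] N N' g f surj.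
have /choice[n nP] : forall b, exists y, g y = f b by move=> b; exact: surj.
have ext (L : lmodType R) (v : M -> L) x t : uniq t -> {subset s x <= t} ->
    \sum_(b <- t) k x b *: v b = \sum_(b <- s x) k x b *: v b.
  move=> ut st; have [us _ k0 _] := skP x.
  rewrite -(sum_extend v (k x) us ut st); apply: eq_bigr => b _.
  by case: ifPn => // /k0 ->.
have sE x : x = \sum_(b <- s x) k x b *: b by have [] := skP x.
pose h x := \sum_(b <- s x) k x b *: n b.
have hlin : linear h.
  move=> a x y.
  (* [t] contains the supports of all three elements, so that independence can compare their
     coordinates. *)
  pose t := undup (s x ++ s y ++ s (a *: x + y)).
  have ut : uniq t by exact: undup_uniq.
  have sx : {subset s x <= t} by move=> b bx; rewrite mem_undup !mem_cat bx.
  have sy : {subset s y <= t}.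
    by move=> b bx; rewrite mem_undup !mem_cat bx !orbT.
  have sz : {subset s (a *: x + y) <= t}.
    by move=> b bx; rewrite mem_undup !mem_cat bx !orbT.
  have tB : [set` t] `<=` B.
    move=> b /=; rewrite mem_undup !mem_cat => /or3P[];
    by [case: (skP x) => _ + _ _; apply|case: (skP y) => _ + _ _; apply
       |case: (skP (a *: x + y)) => _ + _ _; apply].
  have kE b (bt : b \in t) : k (a *: x + y) b = a * k x b + k y b.
    apply/eqP; rewrite -subr_eq0; apply/eqP; move: b bt.
    apply: (indB t (fun b => k (a *: x + y) b - (a * k x b + k y b)) ut tB).
    under eq_bigr do rewrite scalerBl scalerDl -scalerA.
    rewrite sumrB big_split /= -scaler_sumr.
    rewrite (ext _ _ _ _ ut sx) (ext _ _ _ _ ut sy) (ext _ _ _ _ ut sz).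
    by rewrite -!sE subrr.
  rewrite /h -(ext _ _ _ t ut sx) -(ext _ _ _ t ut sy) -(ext _ _ _ t ut sz).
  rewrite scaler_sumr -big_split /=; apply: eq_big_seq => b bt.
  by rewrite kE // scalerDl scalerA.
pose hl : {linear M -> N} := HB.pack h (GRing.isLinear.Build R M N _ h hlin).
exists hl => x; rewrite /= /h raddf_sum [in RHS](sE x).
rewrite raddf_sum; apply: eq_bigr => b _.
by rewrite [LHS]linearZ [RHS]linearZ nP.
Qed.

(** The identity of [M] lifts along the surjection from the free module on the set [M]; the
    coordinates of the lift are the forms [k b]. *)
Lemma projective_dual_basis : projective_module M ->
  exists (s : M -> seq M) (k : M -> {linear M -> R^o}),
    forall x, x = \sum_(b <- s x) k b x *: b.
Proof.
pose F := {freeg M / R}; pose g : F -> M := fglift id.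
have gD : {morph g : x y / x - y} := lift_is_additive (id : M -> M).
pose ga : {additive F -> M} := HB.pack g (GRing.isZmodMorphism.Build F M g gD).
have gE D : g D = \sum_(z <- dom D) coeff z D *: z.
  rewrite -{1}(freeg_sumE D) -[g]/(ga : F -> M) raddf_sum.
  by apply: eq_bigr => z _; exact: liftU.
have gZ : scalable g.
  move=> a D; rewrite [in RHS]gE scaler_sumr.
  rewrite -[a *: D]/(\sum_(x <- dom D) << a * coeff x D *g x >>).
  rewrite -[g]/(ga : F -> M) raddf_sum.
  by apply: eq_bigr => z _; rewrite scalerA; exact: liftU.
pose gl : {linear F -> M} :=
  HB.pack g ga (GRing.isScalable.Build R F M *:%R g gZ).
have gsurj y : exists x, gl x = y.
  by exists << y >>; rewrite /= /g liftU scale1r.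
have idl : linear (id : M -> M) by [].
pose f : {linear M -> M} :=
  HB.pack (id : M -> M) (GRing.isLinear.Build R M M _ id idl).
move=> /(_ _ _ gl f gsurj)[h hP].
have klin b : linear (fun x => coeff b (h x) : R^o).
  by move=> a x y; rewrite linearP coeffD coeffZ.
pose k b : {linear M -> R^o} := HB.pack (fun x => coeff b (h x) : R^o)
  (GRing.isLinear.Build R M R^o _ _ (klin b)).
exists (fun x => dom (h x)), k => x.
by rewrite -[LHS]/(f x) -hP /= gE.
Qed.

End FreeProjective.

(** * Finitely generated idempotent ideals *)

Section IdempotentIdeal.
Variables (R : comNzRingType) (I : set R).

(** For an ideal [I], this is membership in the product of [I] with the ideal generated by [s]. *)
Fixpoint ideal_comb (s : seq R) (x : R) : Prop :=
  if s is a :: s' then exists2 m, I m & ideal_comb s' (x - m * a) else x = 0.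

Hypotheses (I0 : I 0) (ID : forall x y, I x -> I y -> I (x + y)).
Hypothesis IM : forall a x, I x -> I (a * x).

Lemma ideal_comb_lin (s : seq R) (a x y : R) :
  ideal_comb s x -> ideal_comb s y -> ideal_comb s (a * x + y).
Proof.
elim: s x y => [|b s IHs] x y /=; first by move=> -> ->; ring.
move=> [m Im xm] [n In yn]; exists (a * m + n); first by apply/ID/In/IM.
have -> : a * x + y - (a * m + n) * b = a * (x - m * b) + (y - n * b) by ring.
exact: IHs.
Qed.

(* Nakayama's lemma by eliminating the generators of [I] one at a time. *)
Lemma annihilator_witness (s : seq R) :
    {in s, forall a, I a} -> (forall x, I x -> ideal_comb s x) ->
  exists2 u, I u & forall x, I x -> (1 - u) * x = 0.
Proof.
move=> sI sP.
have: exists2 u, I u & forall x, I x -> ideal_comb s ((1 - u) * x).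
  by exists 0 => // x Ix; rewrite subr0 mul1r; exact: sP.
elim: s sI {sP} => [|a s IHs] sI [u Iu uP]; first by exists u.
apply: IHs => [b bs|]; first by apply: sI; rewrite inE bs orbT.
have [m Im am] := uP a (sI a (mem_head _ _)).
(* Modulo combinations of [s], [(1 - u) * a] is [m * a], so [1 - u - m] kills [a]. The new [1 - u]
   is the old one times [1 - u - m]. *)
exists (u + (1 - u) * (u + m)); first by apply: ID => //; apply/IM/ID.
move=> x Ix; have [n In xn] := uP x Ix.
have -> : (1 - (u + (1 - u) * (u + m))) * x =
    n * ((1 - u) * a - m * a) + ((1 - u - m) * ((1 - u) * x - n * a) + 0).
  ring.
apply: ideal_comb_lin am _; apply: ideal_comb_lin xn _.
by elim: (s) => //= b t t0; exists 0 => //; rewrite mul0r subr0.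
Qed.

(** The witness [u] lies in [I], so [(1 - u) * u = 0]: it is an idempotent that acts as 1 on [I]. *)
Lemma indecomposable_trivial_ideal (s : seq R) : indecomposable R ->
    {in s, forall a, I a} -> (forall x, I x -> ideal_comb s x) ->
  I = [set 0] \/ I 1.
Proof.
move=> hR sI sP; have [u Iu uP] := annihilator_witness sI sP.
have /hR[u0|u1] : idempotents R u.
  by apply/eqP; rewrite eq_sym -subr_eq0 -{1}[u]mul1r -mulrBl uP.
- left; apply/seteqP; split => [x Ix|x ->//] /=.
  by rewrite -(uP x Ix) u0 subr0 mul1r.
- by right; rewrite -u1.
Qed.

End IdempotentIdeal.

(** * From projective to Specker *)

Section Specker.
Variables (R : comNzRingType) (S : comPzRingType) (iota : {rmorphism R -> S}).
Local Notation M := (alg_module iota).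

Lemma subalgebra_smallest (D : set S) :
  subalgebra iota (smallest (subalgebra iota) D).
Proof.
split=> [a A [[Aa _ _] _]|x y xD yD A AP|x y xD yD A AP]; first exact: Aa.
- by have [[_ AB _] _] := AP; apply: AB; [exact: xD|exact: yD].
- by have [[_ _ AM] _] := AP; apply: AM; [exact: xD|exact: yD].
Qed.

Lemma alg_scaleE (a : R) (x : M) : a *: x = iota a * (x : S).
Proof. by []. Qed.

(* The values at [e] of the linear forms on [S] form an ideal [I], generated by
   the coordinates [k b e].  As multiplication by [b] is linear, [k b e * f b]
   expands [f e] with coefficients [f (e * b)] in [I], so that [I = I ^ 2]. *)
Lemma projective_idempotent_faithful (e : S) : indecomposable R ->
  projective_module M -> idempotents S e -> e <> 0 -> faithful iota e.
Proof.
move=> hR /projective_dual_basis[s [k sk]] ee e0; split => // a ae0.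
pose I := [set r : R | exists f : {linear M -> R^o}, f e = r].
have I0 : I 0 by exists \0.
have ID x y : I x -> I y -> I (x + y).
  by move=> [f <-] [g <-]; exists (f \+ g).
have IM r x : I x -> I (r * x) by move=> [f <-]; exists (r \*: f).
have eE : e = \sum_(b <- s e) iota (k b e) * b by exact: sk.
have [||I00|[f f1]] := @indecomposable_trivial_ideal R I I0 ID IM
    [seq k b e | b <- s e] hR.
- by move=> _ /mapP[b _ ->]; exists (k b).
- move=> _ [f <-].
  have flin b : linear (fun x : M => f (x * b : S)).
    move=> r x y; rewrite -linearP !alg_scaleE.
    by congr (f _); rewrite mulrDl -mulrA.
  have : f e = \sum_(b <- s e) f (e * b : S) * k b e.
    rewrite -{1}ee {2}eE mulr_sumr raddf_sum; apply: eq_bigr => b _.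
    by rewrite mulrCA [LHS](linearZ_LR f) [RHS]mulrC.
  move=> ->; elim: (s e) => [|b t IHt] /=; first by rewrite big_nil.
  exists (f (e * b : S)).
    exists (HB.pack (fun x : M => f (x * b : S) : R^o)
      (GRing.isLinear.Build R M R^o _ _ (flin b)) : {linear M -> R^o}) => //.
  by rewrite big_cons addrAC subrr add0r.
(* If all forms vanish at [e], so do its coordinates. *)
- exfalso; apply: e0; rewrite eE big1 // => b _.
  have : I (k b e) by exists (k b).
  by rewrite I00 => ->; rewrite rmorph0 mul0r.
- by rewrite -[a]mulr1 -f1 -[a * f e]/(a *: f e) -linearZ alg_scaleE ae0 raddf0.
Qed.

Lemma projective_Specker : indecomposable R -> idempotent_generated iota ->
  projective_module M -> Specker_algebra iota.
Proof.
move=> hR [G [Gid Ggen]] pM; exists (idempotents S); split.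
- split => //; rewrite /idempotents /=.
  + by rewrite mulr0 mulr1.
  + move=> e f ee ff.
    have -> : (e + f - e * f) * (e + f - e * f) = (e * e) + f * f
       + (e * f) *+ 2 + (e * e) * (f * f) - (e * e) * f *+ 2 - (f * f) * e *+ 2.
      ring.
    rewrite ee ff; ring.
  + by move=> e f ee ff; rewrite mulrACA ee ff.
  + by move=> e ee; rewrite mulrBr mulrBl mul1r mulrBl ee; ring.
- rewrite /generates -subTset -Ggen; apply: sub_smallest2r Gid.
  exact: subalgebra_smallest.
- by move=> e eid e0; exact: projective_idempotent_faithful.
Qed.

End Specker.

(** * Well-orders and maximal elements *)

Lemma strict_well_order (T : eqType) : exists lt : T -> T -> Prop,
  [/\ forall x y z, lt x y -> lt y z -> lt x z,
      forall x y, x <> y -> lt x y \/ lt y x & well_founded lt].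
Proof.
have [le wo] := well_ordering_principle T.
have wc : wo_chain le predT by exact: withinW.
have tot x y : le x y || le y x by exact: (wo_chainW wc).
have anti x y : le x y -> le y x -> x = y.
  by move=> xy yx; apply: (wo_chain_antisymmetric wc) => //; rewrite xy.
have tr x y z : le x y -> le y z -> le x z.
  (* Transitivity is read off from the least element of [x], [y], [z]. *)
  move=> xy yz; have [|m [[/= /or3P[]/eqP -> mP] _]] :=
      wo [pred w | [|| w == x, w == y | w == z]].
  - by exists x; rewrite inE eqxx.
  - by apply: mP; rewrite !inE eqxx !orbT.
  - by rewrite (anti x y) // mP // inE eqxx.
  - by rewrite -(anti y z) // mP // !inE eqxx !orbT.
exists (fun x y => le x y /\ x <> y); split.
- move=> x y z [xy nxy] [yz nyz]; split; first exact: tr yz.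
  by move=> xz; apply: nxy; apply: anti => //; rewrite xz.
- by move=> x y nxy; have /orP[] := tot x y; [left|right]; split => // /esym.
- move=> x; apply: contrapT => nx.
  have [|m [[/= /asboolP nm mP] _]] :=
      wo (mem [pred z | `[< ~ Acc (fun x y => le x y /\ x <> y) z >]]).
    by exists x; apply/asboolP.
  apply: nm; constructor => y [ym nym]; apply: contrapT => ny.
  by apply/nym/anti => //; apply: mP; apply/asboolP.
Qed.

(** The relation is only transitive and total on distinct elements, which is what [lex_prec]
    offers. *)
Lemma exists_max (T : eqType) (P : T -> T -> Prop) (s : seq T) :
    (forall x y z, P x y -> P y z -> P x z) ->
    {in s &, forall x y, x <> y -> P x y \/ P y x} -> s != [::] ->
  exists2 m, m \in s & {in s, forall x, x <> m -> P x m}.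
Proof.
move=> Ptr; elim: s => // x [|y s] IHs Ptot _.
  by exists x; rewrite ?mem_head // => z; rewrite inE => /eqP.
have [|//|m ms mP] := IHs.
  by move=> u v us vs; apply: Ptot; rewrite inE ?us ?vs orbT.
have [->|/eqP xm] := eqVneq x m.
  by exists m; rewrite ?mem_head // => z; rewrite inE => /predU1P[->|/mP].
have [Pxm|Pmx] : P x m \/ P m x.
  by apply: Ptot => //; rewrite inE ?eqxx ?ms ?orbT.
- exists m; first by rewrite inE ms orbT.
  by move=> z; rewrite inE => /predU1P[->|/mP].
- exists x; rewrite ?mem_head // => z; rewrite inE => /predU1P[->//|zs] zx.
  have [->//|/eqP zm] := eqVneq z m.
  by apply: Ptr Pmx; exact: mP.
Qed.

(** * Elements of a Specker algebra as locally constant functions *)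

Section Noebeling.
Variables (R : comNzRingType) (S : comPzRingType) (iota : {rmorphism R -> S}).
Variable B : set S.
Hypothesis Bfga : faithful_generating_algebra iota B.
Variable lt : S -> S -> Prop.
Hypothesis lt_trans : forall x y z, lt x y -> lt y z -> lt x z.
Hypothesis lt_total : forall x y, x <> y -> lt x y \/ lt y x.
Implicit Types (D W : set S) (l : seq S).

Let Bidem b : B b -> b * b = b.
Proof. by have [[+ _ _ _ _] _ _] := Bfga; apply. Qed.
Let B1 : B 1. Proof. by have [[_ []]] := Bfga. Qed.
Let BM b c : B b -> B c -> B (b * c).
Proof. by have [[_ _ _ + _] _ _] := Bfga; apply. Qed.
Let BC b : B b -> B (1 - b).
Proof. by have [[_ _ _ _ +] _ _] := Bfga; apply. Qed.

(** Faithfulness enters here: a function has at most one value on a nonempty set. *)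
Let scalar_inj (c : S) (r s : R) :
  B c -> c <> 0 -> iota r * c = iota s * c -> r = s.
Proof.
move=> Bc c0 /eqP; rewrite -subr_eq0 -mulrBl -rmorphB => /eqP rs0.
apply/eqP; rewrite -subr_eq0; apply/eqP; move: rs0.
by have [_ _ /(_ c Bc c0)[_ _]] := Bfga; apply.
Qed.

Let A D : set S := smallest (subalgebra iota) D.

Let A_sub D D' : D `<=` D' -> A D `<=` A D'.
Proof. by apply: sub_smallest2r; exact: subalgebra_smallest. Qed.
Let A_gen D : D `<=` A D. Proof. exact: sub_gen_smallest. Qed.
Let A_scalar D r : A D (iota r).
Proof. by have [+ _ _] := subalgebra_smallest iota D; apply. Qed.
Let A_B D x y : A D x -> A D y -> A D (x - y).
Proof. by have [_ + _] := subalgebra_smallest iota D; apply. Qed.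
Let A_M D x y : A D x -> A D y -> A D (x * y).
Proof. by have [_ _ +] := subalgebra_smallest iota D; apply. Qed.
Let A_0 D : A D 0. Proof. by rewrite -(rmorph0 iota). Qed.
Let A_1 D : A D 1. Proof. by rewrite -(rmorph1 iota). Qed.
Let A_D D x y : A D x -> A D y -> A D (x + y).
Proof. by move=> xD yD; rewrite -[y]opprK -[- y]sub0r; do 2?apply: A_B. Qed.

(** An idempotent [c] of this kind lies in a single cell of the partition cut out by [bs]. *)
Definition decided (bs : seq S) (c : S) :=
  {in bs, forall b, c * b = c \/ c * b = 0}.

(** Cutting [c] along each member of [bs] in turn leaves only decided pieces; [Q] is then glued
    back, with [K] an invariant of the pieces. *)
Lemma split_ind (bs : seq S) (K Q : S -> Prop) :
    {in bs, forall b, b * b = b} ->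
    (forall c b, K c -> b \in bs -> K (c * b) /\ K (c * (1 - b))) ->
    (forall c, K c -> decided bs c -> Q c) ->
    (forall c b, K c -> b \in bs -> Q (c * b) -> Q (c * (1 - b)) -> Q c) ->
  forall c, K c -> Q c.
Proof.
elim: bs => [|b bs IHbs] idem KM dec QM; first by move=> c Kc; exact: dec.
have sub x : x \in bs -> x \in b :: bs by rewrite inE => ->; rewrite orbT.
have bb : b * b = b by apply: idem; rewrite mem_head.
apply: IHbs => [x /sub /idem //|c x Kc /sub xs|c Kc cbs|c x Kc /sub xs].
- exact: KM.
- have [Kb Kb'] := KM c b Kc (mem_head _ _).
  apply: (QM c b) => //; first by rewrite mem_head.
  - apply: dec => // x; rewrite inE => /predU1P[->|/cbs[] cx].
    + by left; rewrite -mulrA bb.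
    + by left; rewrite mulrAC cx.
    + by right; rewrite mulrAC cx mul0r.
  - apply: dec => // x; rewrite inE => /predU1P[->|/cbs[] cx].
    + by right; rewrite -mulrA mulrBl mul1r bb subrr mulr0.
    + by left; rewrite mulrAC cx.
    + by right; rewrite mulrAC cx mul0r.
- exact: QM.
Qed.

Lemma eq_on_atoms (bs : seq S) (x y : S) : {in bs, forall b, B b} ->
  (forall c, B c -> decided bs c -> c * x = c * y) -> x = y.
Proof.
move=> bsB dec; rewrite -[x]mul1r -[y]mul1r.
apply: (@split_ind bs B (fun c => c * x = c * y)) B1 => //.
- by move=> b /bsB /Bidem.
- by move=> c b Bc /bsB Bb; split; apply: BM => //; exact: BC.
- move=> c b Bc bbs cb cb'.
  have E z : c * z = c * b * z + c * (1 - b) * z by ring.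
  by rewrite E cb cb' -E.
Qed.

(** A generator takes only the values 1 and 0; differences and products are constant on a common
    refinement. *)
Lemma locally_scalar D x : A D x -> exists2 bs : seq S, {in bs, forall b, D b} &
  forall c, decided bs c -> exists r, c * x = iota r * c.
Proof.
move: x; apply: smallest_sub => [|b Db]; last first.
  exists [:: b] => [_ /[!inE]/eqP->//|c /(_ b (mem_head _ _))[] ->].
    by exists 1; rewrite rmorph1 mul1r.
  by exists 0; rewrite rmorph0 mul0r.
have cat_dec bs bs' c : decided (bs ++ bs') c -> decided bs c /\ decided bs' c.
  by move=> dec; split=> b bbs; apply: dec; rewrite mem_cat bbs ?orbT.
split => [r|x y [bs bsD xP] [bs' bsD' yP]|x y [bs bsD xP] [bs' bsD' yP]].
- by exists [::] => // c _; exists r; rewrite mulrC.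
- exists (bs ++ bs') => [b|c /cat_dec[/xP[r xr] /yP[s ys]]].
    by rewrite mem_cat => /orP[/bsD|/bsD'].
  by exists (r - s); rewrite mulrBr xr ys rmorphB mulrBl.
- exists (bs ++ bs') => [b|c /cat_dec[/xP[r xr] /yP[s ys]]].
    by rewrite mem_cat => /orP[/bsD|/bsD'].
  by exists (r * s); rewrite mulrA xr -mulrA ys rmorphM mulrA.
Qed.

(* The idempotent [p] is the characteristic function of the level set
   [x = a]. *)
Lemma level_idempotent D (a : R) x : D `<=` B -> A D x -> exists2 p, A D p &
  forall c r, B c -> c * x = iota r * c -> c * p = iota (r == a)%:R * c.
Proof.
move=> DB xD; have [bs bsD xP] := locally_scalar xD.
have := @split_ind bs (fun c => B c /\ A D c) (fun d => exists2 p, A D p &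
  forall c r, B c -> c * x = iota r * c ->
    c * d * p = iota (r == a)%:R * (c * d)).
case/(_ _ _ _ _ 1) => //.
- by move=> b /bsD /DB /Bidem.
- move=> c b [Bc cD] /bsD Db; have Bb := DB _ Db.
  have bD := A_gen Db.
  split; split; [exact: BM|exact: A_M|exact/BM/BC|].
  by apply: A_M => //; exact: A_B.
(* On a decided piece [x] has one value [s], so the characteristic function is constant there. It is
   correct on [c * d] since either this is 0 or [r = s]. *)
- move=> d [Bd dD] /xP[s xs]; exists (iota (s == a)%:R) => // c r Bc xr.
  have [->|/eqP cd0] := eqVneq (c * d) 0; first by rewrite !(mul0r, mulr0).
  suff -> : r = s by rewrite mulrC.
  apply: (scalar_inj (BM Bc Bd) cd0).
  by rewrite mulrA -xr mulrAC -mulrA xs; ring.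
- move=> d b [Bd dD] /bsD Db [p pD pP] [q qD qP].
  exists (b * p + (1 - b) * q).
    have bD := A_gen Db.
    by apply: A_D; apply: A_M => //; exact: A_B.
  move=> c r Bc xr.
  have -> : c * d * (b * p + (1 - b) * q) =
      c * (d * b) * p + c * (d * (1 - b)) * q.
    by ring.
  by rewrite (pP _ _ Bc xr) (qP _ _ Bc xr); ring.
- by move=> p pD pP; exists p => // c r Bc /(pP _ _ Bc); rewrite mulr1.
Qed.

(** * Lexicographic spans of monomials *)

Definition below D e : set S := [set f | D f /\ lt f e].

Lemma below_below D e f : lt e f -> below (below D f) e = below D e.
Proof.
move=> ef; apply/seteqP; split=> g; first by move=> [[Dg _] ge].
by move=> [Dg ge]; split=> //; split=> //; exact: lt_trans ef.
Qed.

Fixpoint descending D l : Prop :=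
  if l is e :: l' then D e /\ descending (below D e) l' else True.

(* [lex_below D l] is the span of the monomials over [D] that precede
   [\prod_(e <- l) e] in the lexicographic order. *)
Fixpoint lex_below D l : set S :=
  if l is e :: l' then
    [set y | exists x z,
       [/\ A (below D e) x, lex_below (below D e) l' z & y = x + e * z]]
  else [set 0].

Lemma below_sub D e : below D e `<=` D. Proof. by move=> f []. Qed.

Lemma lex_below_lin D l r y z :
  lex_below D l y -> lex_below D l z -> lex_below D l (iota r * y + z).
Proof.
elim: l D y z => [|e l IHl] D y z /=.
  by move=> -> ->; rewrite mulr0 addr0.
move=> [x [y' [xD yD ->]]] [t [z' [tD zD ->]]].
exists (iota r * x + t), (iota r * y' + z').
split; [by apply: A_D => //; exact: A_M|exact: IHl|ring].
Qed.

Lemma lex_below0 D l : lex_below D l 0.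
Proof.
elim: l D => //= e l IHl D; exists 0, 0; split=> //.
by rewrite mulr0 addr0.
Qed.

Lemma lex_belowW D l : descending D l -> lex_below D l `<=` A D.
Proof.
elim: l D => [|e l IHl] D /=; first by move=> _ _ ->.
move=> [De dl] _ [x [z [xD zD ->]]].
apply: A_D; first exact: A_sub (@below_sub D e) _ xD.
apply: A_M; first exact: A_gen.
exact: A_sub (@below_sub D e) _ (IHl _ dl _ zD).
Qed.

Lemma descending_prod D l : descending D l -> A D (\prod_(b <- l) b).
Proof.
elim: l D => [|e l IHl] D /=; first by rewrite big_nil.
move=> [De /IHl dl]; rewrite big_cons; apply: A_M; first exact: A_gen.
exact: A_sub (@below_sub D e) _ dl.
Qed.

(* Write [y = x_1 + e_1 x_2 + e_1 e_2 x_3 + ...] and let [t_i] be the suffix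
   sums of the [x_i], so that [t = t_1]. Where [e_k] is the first vanishing
   factor, [y = t_1 - t_(k+1)]. Replacing each [t_i] by the characteristic
   function of the set [t_i = a] then turns [y] into another element [z] of
   [lex_below D l]. On an atom [c], [r] and [s] are the values of [t] and of
   [t_(k+1)]. *)
Lemma lex_below_level D l (a : R) y : D `<=` B -> a <> 0 ->
    descending D l -> lex_below D l y ->
  exists t z bs, [/\ A D t, lex_below D l z, {in bs, forall b, B b} &
    forall c, B c -> decided bs c -> exists r s : R,
      [/\ c * t = iota r * c, c * y = iota (r - s) * c,
          c * z = iota ((r == a)%:R - (s == a)%:R) * c
        & c * \prod_(b <- l) b = c /\ s = 0 \/ c * \prod_(b <- l) b = 0]].
Proof.
move=> + a0; elim: l D y => [|e l IHl] D y DB /=.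
  move=> _ ->; exists 0, 0, [::]; split=> // c Bc _; exists 0, 0.
  rewrite !subrr rmorph0 mulr0 mul0r big_nil mulr1; split=> //.
  by left.
move=> [De dl] [x [y' [xD yD ->]]].
have DB' : below D e `<=` B by apply: subset_trans DB; exact: below_sub.
have [t' [z' [bs' [tD' zD' bsB' H]]]] := IHl _ _ DB' dl yD.
have tD : A (below D e) (x + t') by exact: A_D.
have [p' pD' pP'] := level_idempotent a DB' tD'.
have [p pD pP] := level_idempotent a DB' tD.
have [bs bsD xP] := locally_scalar xD.
exists (x + t'), (p - p' + e * z'), (e :: bs ++ bs'); split.
- exact: A_sub (@below_sub D e) _ tD.
- by exists (p - p'), z'; split=> //; exact: A_B.
- move=> b; rewrite inE mem_cat => /predU1P[->|/orP[/bsD/DB'|/bsB']] //.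
  exact: DB.
move=> c Bc dec.
have [|r xr] := xP c.
  by move=> b bbs; apply: dec; rewrite inE mem_cat bbs orbT.
have [|r' [s' [tr' yr' zr' lr']]] := H c Bc.
  by move=> b bbs; apply: dec; rewrite inE mem_cat bbs !orbT.
have tr : c * (x + t') = iota (r + r') * c.
  by rewrite mulrDr xr tr' rmorphD mulrDl.
have pr := pP _ _ Bc tr; have pr' := pP' _ _ Bc tr'.
(* If [e] is 1 on [c], the first vanishing factor, if any, is in the tail and [s'] is kept.
   Otherwise it is [e] itself, and the suffix sum after it is [t'], of value [r']. *)
rewrite big_cons; have [ce|ce] := dec e (mem_head _ _).
- exists (r + r'), s'; split=> //.
  + by rewrite mulrDr xr mulrA ce yr' -mulrDl -rmorphD addrA.
  + rewrite mulrDr mulrA ce zr' mulrBr pr pr' !rmorphB /=; ring.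
  + by rewrite mulrA ce.
- exists (r + r'), r'; split=> //.
  + by rewrite mulrDr mulrA ce mul0r addr0 xr addrK.
  + by rewrite mulrDr mulrA ce mul0r addr0 mulrBr pr pr' rmorphB mulrBl.
  + by right; rewrite mulrA ce mul0r.
Qed.

Lemma lex_below_torsion_free D l (a : R) : D `<=` B -> a <> 0 ->
    descending D l -> lex_below D l (iota a * \prod_(b <- l) b) ->
  lex_below D l (\prod_(b <- l) b).
Proof.
move=> DB a0 dl /(lex_below_level DB a0 dl)[t [z [bs [_ zD bsB H]]]].
suff <- : z = \prod_(b <- l) b by [].
apply: eq_on_atoms bsB _ => c Bc /(H c Bc)[r [s [_ + -> lc]]].
have [->|/eqP c0] := eqVneq c 0; first by rewrite !(mulr0, mul0r).
case: lc => [[lc ->]|lc]; rewrite mulrCA lc.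
  (* Where the monomial is 1, [r = a] and [s = 0], so [z] has value 1 as [a <> 0]. *)
  move/(scalar_inj Bc c0); rewrite subr0 => <-.
  move/eqP/negbTE: a0; rewrite eqxx eq_sym => ->.
  by rewrite subr0 rmorph1 mul1r.
(* Where the monomial is 0, [r = s] and [z] vanishes. *)
rewrite mulr0 -(mul0r c) -(rmorph0 iota) => /(scalar_inj Bc c0)/esym/eqP.
by rewrite subr_eq0 => /eqP->; rewrite subrr.
Qed.

(* On descending lists, a transitive and total stand-in for the lexicographic
   order. *)
Definition lex_prec D l' l :=
  lex_below D l (\prod_(b <- l') b) /\ lex_below D l' `<=` lex_below D l.

Lemma lex_prec_trans D l1 l2 l3 :
  lex_prec D l1 l2 -> lex_prec D l2 l3 -> lex_prec D l1 l3.
Proof.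
by move=> [p12 s12] [_ s23]; split; [exact: s23|exact: subset_trans s23].
Qed.

(** Both the monomial of [e :: l] and all that precedes it lie in [A (below D f)], the first summand
    of the span for [f :: l']. *)
Lemma lex_prec_lt D e f l l' : descending D (e :: l) -> D f -> lt e f ->
  lex_prec D (e :: l) (f :: l').
Proof.
move=> [De dl] Df ef; rewrite -(below_below _ ef) in dl.
have del : descending (below D f) (e :: l) by [].
have sub x : A (below D f) x -> lex_below D (f :: l') x.
  move=> xD; exists x, 0; split; rewrite ?mulr0 ?addr0 //; exact: lex_below0.
split=> [|x xD]; apply: sub; first exact: descending_prod del.
by apply: (lex_belowW del); rewrite /= below_below.
Qed.

Lemma lex_prec_total D l l' : descending D l -> descending D l' -> l <> l' ->
  lex_prec D l l' \/ lex_prec D l' l.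
Proof.
have nilP E e k : lex_prec E [::] (e :: k).
  split=> [|_ ->]; last exact: lex_below0.
  exists 1, 0; split; rewrite ?big_nil ?mulr0 ?addr0 //; exact: lex_below0.
elim: l l' D => [|e l IHl] [|f l'] D //; [by left|by right|].
move=> del dfl nll; have [De dl] := del; have [Df dl'] := dfl.
have [ef|/eqP ef] := eqVneq e f; last first.
  by have [?|?] := lt_total ef; [left|right]; apply: lex_prec_lt.
rewrite -{}ef {f} in Df dl' dfl nll *.
have cons k k' : lex_prec (below D e) k k' -> lex_prec D (e :: k) (e :: k').
  move=> [kk sub]; split=> [|_ [x [z [xD zD ->]]]].
    by exists 0, (\prod_(b <- k) b); rewrite big_cons add0r.
  by exists x, z; split=> //; exact: sub.
have [||ll|?|?] := IHl l' (below D e) => //.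
- by apply: nll; rewrite ll.
- by left; exact: cons.
- by right; exact: cons.
Qed.

(** * Independence of the Noebeling basis *)

Definition Noebeling_basis : set S :=
  [set m | exists l,
    [/\ descending B l, m = \prod_(b <- l) b & ~ lex_below B l m]].

Lemma Noebeling_basis_independent :
  linearly_independent (Noebeling_basis : set (alg_module iota)).
Proof.
move=> s c us sE sum0.
have /choice[lam lamP] : forall m : S, exists l, Noebeling_basis m ->
    [/\ descending B l, m = \prod_(b <- l) b & ~ lex_below B l m].
  move=> m; have [[l lP]|nm] := pselect (Noebeling_basis m); first by exists l.
  by exists [::].
apply: contrapT => /existsNP[b0 /not_implyP[b0s /eqP cb0]].
pose s' := [seq b <- s | c b != 0].
have [||| m ms mP] :=
    @exists_max _ (fun x y : S => lex_prec B (lam x) (lam y)) s'.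
- by move=> x y z; exact: lex_prec_trans.
- move=> x y; rewrite !mem_filter => /andP[_ /sE xE] /andP[_ /sE yE] nxy.
  have [dx x_prod _] := lamP x xE; have [dy y_prod _] := lamP y yE.
  by apply: lex_prec_total => // xy; apply: nxy; rewrite x_prod xy.
- apply/eqP => s0; have : b0 \in s' by rewrite mem_filter cb0.
  by rewrite s0.
move: ms; rewrite mem_filter => /andP[/eqP cm ms].
have [dm m_prod] := lamP m (sE _ ms); apply.
rewrite [X in lex_below _ _ X]m_prod.
(* For the largest [m] in the support, [c m * m] is minus the sum of the other terms, which lies in
   the span below [m]. *)
apply: (lex_below_torsion_free (a := c m)) => //; rewrite -m_prod.
move: sum0; rewrite (bigD1_seq m) //= alg_scaleE => /(canRL (addrK _)).
rewrite add0r => ->; rewrite -mulN1r -(rmorph1 iota) -rmorphN.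
rewrite -[X in lex_below _ _ X]addr0.
apply: lex_below_lin; last exact: lex_below0.
rewrite big_seq_cond; elim/big_ind: _ => [|x y xm ym|b /andP[bs /eqP bm]].
- exact: lex_below0.
- by rewrite -[x]mul1r -(rmorph1 iota); exact: lex_below_lin.
have [cb|cb] := eqVneq (c b) 0; first by rewrite cb scale0r; exact: lex_below0.
have [_ b_prod _] := lamP b (sE _ bs).
rewrite alg_scaleE -[_ * _]addr0; apply: lex_below_lin; last exact: lex_below0.
rewrite {1}b_prod; have [|+ _] := mP b _ bm; last by [].
by rewrite mem_filter cb.
Qed.

(** * Spanning by the Noebeling basis *)

Fixpoint rest D l : set S := if l is e :: l' then rest (below D e) l' else D.

Lemma rest_sub D l : rest D l `<=` D.
Proof.
elim: l D => [|e l IHl] D //=.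
by apply: subset_trans (IHl _) _; exact: below_sub.
Qed.

Lemma rest_rcons D l f : rest D (rcons l f) = below (rest D l) f.
Proof. by elim: l D => //= e l IHl D; rewrite IHl. Qed.

Lemma descending_rcons D l f :
  descending D l -> rest D l f -> descending D (rcons l f).
Proof.
elim: l D => [|e l IHl] D //= [De dl] rf; split=> //; exact: IHl.
Qed.

(** A monomial preceding [rcons l f] either precedes [l] or extends [l], possibly trivially, by
    letters below [f]. *)
Lemma lex_below_rcons D l f y : lex_below D (rcons l f) y ->
  exists z x, [/\ lex_below D l z, A (below (rest D l) f) x
                & y = z + \prod_(b <- l) b * x].
Proof.
elim: l D y => [|e l IHl] D y /=.
  move=> [x [_ [xD -> ->]]]; exists 0, x; split=> //.
  by rewrite big_nil mulr0 mul1r addr0 add0r.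
move=> [x [_ [xD /IHl[z [x' [zD xD' ->]]] ->]]].
exists (x + e * z), x'; split=> //; first by exists x, z.
by rewrite big_cons; ring.
Qed.

Definition lin_closed W : Prop :=
  W 0 /\ forall r x y, W x -> W y -> W (iota r * x + y).

(** Sorting a monomial by its largest letter shows that 1 and the products [f * x] span [A D]. *)
Lemma generated_ind D W : D `<=` B -> lin_closed W -> W 1 ->
    (forall f x, D f -> A (below D f) x -> W (f * x)) -> A D `<=` W.
Proof.
move=> DB linW W1 Wf.
(* Closure under multiplication by generators is shown for the span [T], since [W] need not have
   it. *)
pose T0 : set S := [set x | x = 1 \/
  exists f y, [/\ D f, A (below D f) y & x = f * y]].
pose T := smallest lin_closed T0.
have [T_0 T_lin] : lin_closed T.
  split=> [|r x y Tx Ty] V VP; have [[V0 Vlin] _] := VP; first exact: V0.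
  by apply: Vlin; [exact: Tx|exact: Ty].
have T_1 : T 1 by apply: sub_gen_smallest; left.
have T_f f x : D f -> A (below D f) x -> T (f * x).
  by move=> Df xD; apply: sub_gen_smallest; right; exists f, x.
have TW : T `<=` W.
  by apply: smallest_sub => // _ [->//|[f [x [Df xD ->]]]]; exact: Wf.
have TM y : A D y -> forall x, T x -> T (y * x).
  move: y; apply: smallest_sub => [|g Dg].
    split=> [r x Tx|y z Ty Tz x Tx|y z Ty Tz x Tx].
    - by rewrite -[_ * _]addr0; exact: T_lin Tx T_0.
    - have -> : (y - z) * x = iota (-1) * (z * x) + y * x.
        by rewrite rmorphN rmorph1; ring.
      by apply: T_lin; [exact: Tz Tx|exact: Ty Tx].
    - by rewrite -mulrA; exact: Ty (Tz _ Tx).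
  apply: (@smallest_sub _ _ _ [set x | T (g * x)]) =>
    [|_ [->|[f [x [Df xD ->]]]]] /=.
  - split=> [|r x y Tx Ty] /=; first by rewrite mulr0.
    by rewrite mulrDr mulrCA; exact: T_lin Tx Ty.
  - exact: T_f.
  - have [->|/eqP gf] := eqVneq g f.
      by rewrite mulrA Bidem; [exact: T_f|exact: DB].
    have [lt_gf|lt_fg] := lt_total gf.
    + by rewrite mulrCA; apply: T_f => //; apply: A_M => //; exact: A_gen.
    + apply: T_f => //; apply: A_M; first exact: A_gen.
      by apply: A_sub xD => h [Dh hf]; split=> //; exact: lt_trans lt_fg.
by move=> y yD; rewrite -[y]mulr1; exact: TW (TM _ yD _ T_1).
Qed.

Hypothesis lt_wf : well_founded lt.

(** Lexicographic induction becomes induction on the letter [e], with the prefix [l] arbitrary in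
    [C e]. *)
Lemma Noebeling_basis_spans W :
  lin_closed W -> Noebeling_basis `<=` W -> W = setT.
Proof.
move=> linW EW; have [W0 Wlin] := linW.
pose C e := forall l, descending B l -> lex_below B l `<=` W ->
  forall x, A (below (rest B l) e) x -> W (\prod_(b <- l) b * x).
have step l D : descending B l -> lex_below B l `<=` W -> D `<=` rest B l ->
    (forall f, D f -> C f) -> forall x, A D x -> W (\prod_(b <- l) b * x).
  move=> dl lW Dl CD.
  pose W' : set S := [set x | W (\prod_(b <- l) b * x)].
  apply: (@generated_ind D W').
  - by apply: subset_trans Dl _; exact: rest_sub.
  - rewrite /W'; split=> [|r x y Wx Wy] /=; first by rewrite mulr0.
    by rewrite mulrDr mulrCA; exact: Wlin.
  - rewrite /W' /= mulr1.
    have [/lW//|nl] := pselect (lex_below B l (\prod_(b <- l) b)).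
    by apply: EW; exists l.
  - move=> f x Df xD; have lf := Dl _ Df.
    rewrite /W' /= mulrA -big_rcons; apply: (CD f Df (rcons l f)).
    + exact: descending_rcons.
    (* To use [C f] at [rcons l f], all smaller monomials must lie in [W]; those extending [l] do by
       [C f] at [l]. *)
    + move=> _ /lex_below_rcons[z [y [zl yl ->]]].
      rewrite addrC -[X in X + z]mul1r -[X in X * _](rmorph1 iota).
      by apply: Wlin; [exact: (CD f Df l dl lW y yl)|exact: lW].
    + rewrite rest_rcons; apply: A_sub xD => g [Dg gf].
      by split=> //; split=> //; exact: Dl.
have CP e : C e.
  elim/(well_founded_ind lt_wf): e => e IHe l dl lW.
  by apply: step => // [|f []]; [exact: below_sub|move=> _; exact: IHe].
rewrite -subTset => x _; have [_ Bgen _] := Bfga.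
suff: W (\prod_(b <- [::]) b * x) by rewrite big_nil mul1r.
apply: (step [::] B) => //.
- by move=> _ ->.
- by rewrite /A Bgen.
Qed.

End Noebeling.

(** * The equivalence *)

Lemma Specker_free (R : comNzRingType) (S : comPzRingType)
    (iota : {rmorphism R -> S}) :
  Specker_algebra iota -> free_module (alg_module iota).
Proof.
move=> [B Bfga]; have [lt [lt_trans lt_total lt_wf]] := strict_well_order S.
exists (Noebeling_basis iota B lt); split.
  exact: Noebeling_basis_independent.
pose E : set (alg_module iota) := Noebeling_basis iota B lt.
suff W : lin_combs E = setT by move=> x; have : setT x by []; rewrite -W.
apply: (Noebeling_basis_spans Bfga lt_trans lt_total lt_wf).
  by split=> [|r x y]; [exact: lin_combs0|exact: lin_combs_lin].
exact: (@sub_lin_combs _ _ E).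
Qed.

Theorem theorem3p12 (R : comNzRingType) (S : comPzRingType)
    (iota : {rmorphism R -> S})
    (hR : indecomposable R) (hS : idempotent_generated iota) :
  [<-> Specker_algebra iota;
       free_module (alg_module iota);
       projective_module (alg_module iota)].
Proof.
tfae.
- exact: Specker_free.
- exact: free_projective.
- exact: projective_Specker.
Qed.
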